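(* Let $p$ be a prime, $\alpha$ a positive integer and $\ell\ge 2$ an integer, and let $G=(\mathbb{Z}/p^{\alpha}\mathbb{Z})^{\ell}$. Then for every $(a_1,\dots,a_\ell)\in G$, the $(a_1,\dots,a_\ell)$-annihilator of $G$ is $[(a_1,\dots,a_\ell):G]=p^{\alpha}\mathbb{Z}$. In particular, the group-annihilator graph $\Gamma(G)$ is a complete graph.
   Context: For a finite abelian group $G$ viewed as a $\mathbb{Z}$-module and $x\in G$, $[x:G]=\{r\in\mathbb{Z} : rG\subseteq\mathbb{Z}x\}$, an ideal of $\mathbb{Z}$. The group-annihilator graph $\Gamma(G)$ is the simple graph with vertex set $G$ in which two distinct vertices $x,y$ are adjacent if and only if $[x:G][y:G]G=\{0\}$, where $[x:G][y:G]$ is the product of ideals of $\mathbb{Z}$. *)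

(* Defs.v *)
From HB Require Import structures.
From mathcomp Require Import all_boot all_order all_algebra.
From mathcomp Require Import boolp classical_sets.

Set Implicit Arguments.
Unset Strict Implicit.
Unset Printing Implicit Defensive.

Import GRing.Theory.

Local Open Scope classical_set_scope.
Local Open Scope ring_scope.

Definition principal_ideal (d : int) : set int := [set k * d | k in [set: int]].

(* Products of ideals and of an ideal with a module consist of all finite sums
   of elementwise products; the empty sum (n = 0) is allowed. *)
Definition ideal_mul (I J : set int) : set int :=
  [set r | exists (n : nat) (a b : 'I_n -> int),
      [/\ forall i, I (a i), forall i, J (b i) & r = \sum_(i < n) a i * b i]].

Definition ideal_act (I : set int) (G : zmodType) : set G :=
  [set g | exists (n : nat) (a : 'I_n -> int) (h : 'I_n -> G),
      (forall i, I (a i)) /\ g = \sum_(i < n) h i *~ a i].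

Arguments ideal_act : clear implicits.

(* A zmodType is a Z-module through  g *~ r;  this is  [x : G]. *)
Definition annihilator_of (G : zmodType) (x : G) : set int :=
  [set r | [set g *~ r | g in [set: G]] `<=` [set x *~ n | n in [set: int]]].

Record simple_graph (V : Type) := SimpleGraph {
  adjacent : V -> V -> Prop;
  adjacent_irrefl : forall x, ~ adjacent x x;
  adjacent_sym : forall x y, adjacent x y -> adjacent y x
}.

Definition complete_graph (V : Type) (Gamma : simple_graph V) : Prop :=
  forall x y : V, x <> y -> adjacent Gamma x y.

Lemma ideal_mulC (I J : set int) : ideal_mul I J = ideal_mul J I.
Proof.
suff sub (A B : set int) : ideal_mul A B `<=` ideal_mul B A.
  by apply/seteqP; split; apply: sub.
move=> _ [n [a [b [Aa Bb ->]]]]; exists n, b, a; split=> //.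
by apply: eq_bigr => i _; rewrite mulrC.
Qed.

Definition group_annihilator_adj (G : finZmodType) (x y : G) : Prop :=
  x <> y /\
  ideal_act (ideal_mul (annihilator_of x) (annihilator_of y)) G = [set 0].

Lemma group_annihilator_adj_irrefl (G : finZmodType) (x : G) :
  ~ group_annihilator_adj x x.
Proof. by case. Qed.

Lemma group_annihilator_adj_sym (G : finZmodType) (x y : G) :
  group_annihilator_adj x y -> group_annihilator_adj y x.
Proof. by case=> xy e; split; [exact: nesym | rewrite ideal_mulC]. Qed.

Definition group_annihilator_graph (G : finZmodType) : simple_graph G :=
  SimpleGraph (@group_annihilator_adj_irrefl G) (@group_annihilator_adj_sym G).

(* Main.v *)
(* If r kills G modulo Z a, then r e_i = n a and r e_j = m a for two distinct
   coordinates i, j.  Comparing these coordinates gives n a_i = r = m a_j and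
   n a_j = 0 = m a_i in Z/p^alpha.  Divisibility is total in Z/p^alpha: if
   a_j = c a_i then r = m a_j = c m a_i = 0, and symmetrically. *)

Require Import Defs.
From HB Require Import structures.
From mathcomp Require Import all_boot all_order all_algebra.
From mathcomp Require Import boolp classical_sets.

Set Implicit Arguments.
Unset Strict Implicit.
Unset Printing Implicit Defensive.

Import GRing.Theory.

Local Open Scope classical_set_scope.
Local Open Scope ring_scope.

Lemma prime_expn_gt1 (p n : nat) : prime p -> (0 < n)%N -> (1 < p ^ n)%N.
Proof. by move=> p_prime n_gt0; rewrite -(exp1n n) ltn_exp2r // prime_gt1. Qed.

(** For [q <= 1] the type ['Z_q] is Z/2Z, so the bound on [q] is what makes it the ring of residues
    modulo [q]. *)
Lemma Zp_intr_eq0 (q : nat) (r : int) : (1 < q)%N ->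
  (r%:~R == 0 :> 'Z_q) = (q %| r)%Z.
Proof.
move=> q_gt1.
have natr_eq0 n : (n%:R == 0 :> 'Z_q) = (q %| n)%N.
  by rewrite -val_eqE /= val_Zp_nat.
by case: r => n; rewrite ?NegzE ?mulrNz ?oppr_eq0 -pmulrn natr_eq0 /dvdz ?abszN.
Qed.

(** Bezout gives [s] such that [q] divides gcd(q, x) + s x; reduction modulo [q] leaves gcd(q, x) =
    - s x. Since the gcd also divides [x], both generate the same ideal of ['Z_q]. *)
Lemma Zp_gcdnE (q : nat) (x : 'Z_q) : (1 < q)%N ->
  exists s : 'Z_q, (gcdn q x)%:R = s * x.
Proof.
move=> q_gt1; have [s _] := Bezoutl x (ltnW q_gt1).
case/dvdnP=> k /(congr1 (fun n => n%:R : 'Z_q)).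
rewrite natrD !natrM pchar_Zp // mulr0 natr_Zp => /eqP; rewrite addr_eq0 => /eqP->.
by exists (- s%:R); rewrite mulNr.
Qed.

(** Divisibility in ['Z_q] reduces to divisibility between gcds with [q]. These divide p^alpha,
    hence are powers of p, and such powers form a chain. *)
Lemma Zp_pfactor_dvd_total (p alpha : nat) (x y : 'Z_(p ^ alpha)) :
  prime p -> (0 < alpha)%N -> (exists c, y = c * x) \/ (exists c, x = c * y).
Proof.
move=> p_prime alpha_gt0; set q := (p ^ alpha)%N in x y *.
have q_gt1 : (1 < q)%N by exact: prime_expn_gt1.
have dvd_of_gcdn (u v : 'Z_q) :
    (gcdn q u %| gcdn q v)%N -> exists c, v = c * u.
  move=> guv; have [s guE] := Zp_gcdnE u q_gt1.
  have /dvdnP[k vE] : (gcdn q u %| v)%N := dvdn_trans guv (dvdn_gcdr _ _).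
  by exists (k%:R * s); rewrite -mulrA -guE -natrM -vE natr_Zp.
have /(dvdn_pfactor _ _ p_prime)[i _ gxE] := dvdn_gcdl q x.
have /(dvdn_pfactor _ _ p_prime)[j _ gyE] := dvdn_gcdl q y.
case/orP: (leq_total i j) => ij; [left|right]; apply: dvd_of_gcdn;
  by rewrite gxE gyE dvdn_exp2l.
Qed.

Lemma rV_Zp_mulrz_eq0 (q l : nat) (g : 'rV['Z_q]_l) (r : int) :
  (1 < q)%N -> (q %| r)%Z -> g *~ r = 0.
Proof.
move=> q_gt1 q_r; rewrite -scaler_int.
by move: q_r; rewrite -Zp_intr_eq0 // => /eqP->; rewrite scale0r.
Qed.

Lemma principal_idealE (d r : int) : principal_ideal d r <-> (d %| r)%Z.
Proof.
split=> [[k _ <-]|/dvdzP[k ->]]; last by exists k.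
exact: dvdz_mull.
Qed.

Lemma annihilator_of_rV_Zp (p alpha l : nat) (a : 'rV['Z_(p ^ alpha)]_l) :
  prime p -> (0 < alpha)%N -> (1 < l)%N ->
  annihilator_of a = principal_ideal (p ^ alpha)%N%:Z.
Proof.
move=> p_prime alpha_gt0 l_gt1; set q := (p ^ alpha)%N in a *.
have q_gt1 : (1 < q)%N by exact: prime_expn_gt1.
apply/seteqP; split=> r; last first.
  move/principal_idealE=> q_r _ [g _ <-].
  (* A multiple of [q] kills every [g], so the image is the zero multiple of [a]. *)
  by exists 0; rewrite ?mulr0z ?rV_Zp_mulrz_eq0.
move=> ann_r; apply/principal_idealE; rewrite -Zp_intr_eq0 //.
(* The inclusion is tested on the basis vector e_i and read off at each coordinate k. *)
have coordE i : exists n : int, forall k, n%:~R * a 0 k = r%:~R * (k == i)%:R.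
  have [|n _ nE] := ann_r (delta_mx 0 i *~ r); first by exists (delta_mx 0 i).
  exists n => k; have := congr1 (fun M : 'rV_l => M 0 k) nE.
  by rewrite /= -!scaler_int !mxE eqxx.
(* These are the coordinates 0 and 1, which exist because the rank is at least 2. *)
pose i := Ordinal (ltnW l_gt1); pose j := Ordinal l_gt1.
have [[n nE] [m mE]] := (coordE i, coordE j).
have [naj mai] : n%:~R * a 0 j = 0 /\ m%:~R * a 0 i = 0.
  by rewrite nE mE !mulr0.
have [nai maj] : n%:~R * a 0 i = r%:~R /\ m%:~R * a 0 j = r%:~R.
  by rewrite nE mE !eqxx !mulr1.
case: (Zp_pfactor_dvd_total (a 0 i) (a 0 j) p_prime alpha_gt0) => -[c cE].
- by rewrite -maj cE mulrCA mai mulr0.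
- by rewrite -nai cE mulrCA naj mulr0.
Qed.

Theorem theorem2 (p alpha l : nat) (p_prime : prime p)
    (alpha_gt0 : (0 < alpha)%N) (l_ge2 : (2 <= l)%N) :
  (forall a : 'rV['Z_(p ^ alpha)]_l,
     annihilator_of a = principal_ideal (p ^ alpha)%N%:Z) /\
  complete_graph (group_annihilator_graph 'rV['Z_(p ^ alpha)]_l).
Proof.
have annE (a : 'rV['Z_(p ^ alpha)]_l) :=
  annihilator_of_rV_Zp a p_prime alpha_gt0 l_ge2.
split=> // x y xy; split=> //; rewrite !annE.
have q_gt1 : (1 < p ^ alpha)%N by exact: prime_expn_gt1.
apply/seteqP; split=> [_ [n [r [h [r_mul ->]]]]|_ ->]; last first.
  (* The empty sum represents 0. *)
  exists 0%N, (fun=> 0), (fun=> 0); split; first by case.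
  by rewrite big_ord0.
(* Each coefficient [r i] is a sum of products whose first factor lies in p^alpha Z, so it kills
   [h i]. *)
rewrite /= big1 // => i _; apply: rV_Zp_mulrz_eq0 => //.
have [k [b [c [bI _ ->]]]] := r_mul i.
by apply: rpred_sum => t _; apply/dvdz_mulr/principal_idealE/bI.
Qed.
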